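(* Let $\mathcal{L}:\mathcal{Y}\to\mathcal{X}$ be a linear operator with solution operator $\mathcal{S}:\mathcal{X}\to\mathcal{Y}$ satisfying the standing assumptions given in the context, with singular value–function triples $\{\lambda_i,\hat u_i,\hat v_i\}_{i=1}^\infty$. Fix an integer $n>0$ and define the Kolmogorov $n$-width $$\mathcal{K}_n(\mathcal{S})=\min_{v_1,\dots,v_n\in\mathcal{X}}\ \max_{f\in\mathcal{X},\, f\neq 0}\ \min_{c_1,\dots,c_n\in\mathbb{R}}\frac{\left\|\mathcal{S}(f)-\sum_{i=1}^n c_i\,\mathcal{S}(v_i)\right\|_{\mathcal{Y}}}{\|f\|_{\mathcal{X}}}.$$ Then $\mathcal{K}_n(\mathcal{S})=\lambda_{n+1}$, and the (outer) minimum is achieved by $(v_1,\dots,v_n)=(\hat v_1,\dots,\hat v_n)$. Equivalently, for any $u\in\mathcal{U}=\{\mathcal{S}(f): f\in\mathcal{X}\}$, $$\left\|u-\sum_{i=1}^n\lambda_i\hat c_i\hat u_i\right\|_{\mathcal{Y}}\le\lambda_{n+1}\|\mathcal{L}(u)\|_{\mathcal{X}},\qquad \hat c_i=\langle\mathcal{L}(u),\hat v_i\rangle_{\mathcal{X}}.$$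
   Context: $\mathcal{X}$ and $\mathcal{Y}$ are (real) Hilbert spaces of functions on $\mathbb{R}^d$, with inner products $\langle\cdot,\cdot\rangle_{\mathcal{X}}$, $\langle\cdot,\cdot\rangle_{\mathcal{Y}}$ and associated norms. The linear operator $\mathcal{L}:\mathcal{Y}\to\mathcal{X}$ defines the equation $\mathcal{L}(u(x))=f(x)$, $x\in\Omega$, with $u$ the solution and $f$ the source. Standing assumptions: the equation admits a Green's function $G(x;z)\in\mathcal{S}'(\mathbb{R}^d)$ (tempered distributions), defined for each $z\in\Omega$ as the weak solution of $\mathcal{L}(G(x;z))=\delta_z(x)$, $x\in\Omega$. The linear solution operator is $\mathcal{S}(f)(x)=\int_\Omega G(x;z)f(z)\,\mathrm{d}z$ for $f\in\mathcal{X}$. It is assumed that $\mathcal{S}$ is a bounded injective operator from $\mathcal{X}$ to $\mathcal{Y}$, that the solution of $\mathcal{L}(u)=f$ is $u=\mathcal{S}(f)$, and that $\mathcal{S}^*\mathcal{S}:\mathcal{X}\to\mathcal{X}$ is compact, where $\mathcal{S}^*$ is the adjoint of $\mathcal{S}$. Singular value decomposition: $\{\lambda_i,\hat u_i,\hat v_i\}_{i=1}^\infty$ satisfies $\mathcal{S}(\hat v_i)=\lambda_i\hat u_i$ and $\mathcal{S}^*(\hat u_i)=\lambda_i\hat v_i$ for $i=1,2,\dots$, where $\{\hat u_i\}$ and $\{\hat v_i\}$ form orthonormal bases of $\mathcal{Y}$ and $\mathcal{X}$ respectively, and the singular values are assumed distinct: $\lambda_1>\lambda_2>\lambda_3>\cdots>0$.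 *)

(* Defs.v *)
From HB Require Import structures.
From mathcomp Require Import all_boot all_order all_algebra sesquilinear.
From mathcomp Require Import all_classical all_reals all_analysis.

Set Implicit Arguments.
Unset Strict Implicit.
Unset Printing Implicit Defensive.

Import Order.TTheory GRing.Theory Num.Theory.
Import numFieldNormedType.Exports.

Local Open Scope classical_set_scope.
Local Open Scope ring_scope.

(* The library has Lebesgue measure on R and binary products of measures only.
   On d.-tuple R we iterate the product, transporting it along
   (x, t) |-> x :: t; on 'rV[R]_d we integrate through [row_of]. *)

Definition cons_pair (R : realType) (d : nat)
    (p : measurableTypeR R * d.-tuple (measurableTypeR R)) :
    d.+1.-tuple (measurableTypeR R) := [tuple of p.1 :: p.2].

Lemma measurable_cons_pair (R : realType) (d : nat) :
  measurable_fun [set: _] (@cons_pair R d).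
Proof. exact: measurable_cons. Qed.

Section lebesgue_cons.
Context (R : realType) (d : nat).
Variable mu :
  {sigma_finite_measure set (d.-tuple (measurableTypeR R)) -> \bar R}.
Local Open Scope ereal_scope.

Definition lebesgue_cons (A : set (d.+1.-tuple (measurableTypeR R))) : \bar R :=
  (@lebesgue_measure R \x mu) (@cons_pair R d @^-1` A).

Let measurable_pre A : measurable A -> measurable (@cons_pair R d @^-1` A).
Proof. by move=> mA; rewrite -[X in measurable X]setTI; exact: measurable_cons_pair. Qed.

Let lebesgue_cons0 : lebesgue_cons set0 = 0.
Proof. by rewrite /lebesgue_cons preimage_set0 measure0. Qed.

Let lebesgue_cons_ge0 A : 0 <= lebesgue_cons A.
Proof. exact: measure_ge0. Qed.

Let lebesgue_cons_sigma_additive : semi_sigma_additive lebesgue_cons.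
Proof.
move=> F mF tF mUF; rewrite /lebesgue_cons preimage_bigcup.
apply: measure_semi_sigma_additive => [k||].
- exact: measurable_pre.
- apply/trivIsetP => i j _ _ ij.
  move/trivIsetP : tF => /(_ i j Logic.I Logic.I ij) FF.
  by rewrite -preimage_setI FF preimage_set0.
- by rewrite -preimage_bigcup; exact: measurable_pre.
Qed.

HB.instance Definition _ := isMeasure.Build _ _ _ lebesgue_cons
  lebesgue_cons0 lebesgue_cons_ge0 lebesgue_cons_sigma_additive.

Let lebesgue_cons_sigma_finite : sigma_finite setT lebesgue_cons.
Proof.
have [F TF Foo] : sigma_finite setT (@lebesgue_measure R \x mu).
  have /sigma_finiteP[F [TF ndF Foo]] := sigma_finiteT (@lebesgue_measure R).
  have /sigma_finiteP[G [TG ndG Goo]] := sigma_finiteT mu.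
  exists (fun n => F n `*` G n).
    rewrite -setXTT TF TG predeqE => -[x y]; split.
      move=> [/= [n _ Fnx] [k _ Gky]]; exists (maxn n k) => //; split.
      - by move: x Fnx; exact/subsetPset/ndF/leq_maxl.
      - by move: y Gky; exact/subsetPset/ndG/leq_maxr.
    by move=> [n _ []/= ? ?]; split; exists n.
  move=> k; have [? ?] := Foo k; have [? ?] := Goo k.
  split; first exact: measurableX.
  by rewrite product_measure1E// lte_mul_pinfty// ge0_fin_numE.
pose g (t : d.+1.-tuple (measurableTypeR R)) :
  measurableTypeR R * d.-tuple (measurableTypeR R) := (thead t, [tuple of behead t]).
have gK : cancel (@cons_pair R d) g.
  by move=> [x t]; rewrite /g /cons_pair/= theadE; congr pair; exact: val_inj.
have mg : measurable_fun setT g.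
  apply: measurable_fun_pair; first exact: measurable_tnth.
  exact: measurable_behead.
exists (fun n => g @^-1` F n); first by rewrite -preimage_bigcup -TF preimage_setT.
move=> n; have [mF Fn] := Foo n; split.
  by rewrite -[X in measurable X]setTI; exact: mg.
rewrite /lebesgue_cons -comp_preimage (_ : g \o _ = id) ?preimage_id//.
exact/funext.
Qed.

HB.instance Definition _ := Measure_isSigmaFinite.Build _ _ _ lebesgue_cons
  lebesgue_cons_sigma_finite.

End lebesgue_cons.

Fixpoint lebesgueRd (R : realType) (d : nat) :
    {sigma_finite_measure set (d.-tuple (measurableTypeR R)) -> \bar R} :=
  match d with
  | 0 => dirac [tuple]
  | d'.+1 => lebesgue_cons (lebesgueRd R d')
  end.

Lemma lebesgueRd_box (R : realType) (d : nat) (B : 'I_d -> set (measurableTypeR R)) :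
  (forall i, measurable (B i)) ->
  lebesgueRd R d [set t | forall i, B i (tnth t i)] =
  (\prod_(i < d) lebesgue_measure (B i))%E.
Proof.
elim: d B => [|d IH] B mB /=.
  by rewrite big_ord0 diracE mem_set// => -[].
rewrite big_ord_recl -(IH (fun i => B (lift ord0 i)))// /lebesgue_cons.
rewrite -product_measure1E//.
- congr (product_measure1 _ _ _); apply/seteqP; split => -[x t] /=.
    move=> xt; split; first by have := xt ord0; rewrite tnth0.
    by move=> i; have := xt (lift ord0 i); rewrite tnthS.
  by move=> [Bx Bt] i; have [j ->|->] := unliftP ord0 i; rewrite ?tnth0 ?tnthS.
- rewrite (_ : [set t | _] = \bigcap_(i in setT) ((@tnth d R ^~ i) @^-1` B (lift ord0 i))).
    apply: fin_bigcap_measurable => // i _.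
    by rewrite -[X in measurable X]setTI; exact: measurable_tnth.
  by apply/seteqP; split => t h i; [move=> _; exact: h|exact: (h i Logic.I)].
Qed.

Definition row_of (R : realType) (d : nat) (t : d.-tuple (measurableTypeR R)) :
  'rV[R]_d := \row_(i < d) tnth t i.

Section integration_Rd.
Context (R : realType) (d : nat).
Implicit Types (A : set 'rV[R]_d) (f g : 'rV[R]_d -> R).

Definition measurable_set_Rd A := measurable (@row_of R d @^-1` A).

Definition measurable_fun_Rd f := measurable_fun [set: _] (f \o @row_of R d).

Definition ae_eq_Rd f g := {ae lebesgueRd R d, forall t, f (row_of t) = g (row_of t)}.

Definition integrable_Rd A f :=
  (lebesgueRd R d).-integrable (@row_of R d @^-1` A) (EFin \o (f \o @row_of R d)).

Definition integral_Rd A f : R :=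
  \int[lebesgueRd R d]_(t in @row_of R d @^-1` A) f (row_of t).

End integration_Rd.

Section distributions.
Context (R : realType) (d : nat).
Implicit Types (phi psi : 'rV[R]_d -> R) (Omega : set 'rV[R]_d).

Definition partial_derive (i : 'I_d) phi : 'rV[R]_d -> R :=
  fun x => 'D_('e_i) phi x.

Definition iter_derive (s : seq 'I_d) phi : 'rV[R]_d -> R :=
  foldr partial_derive phi s.

Definition smooth phi := forall s x, differentiable (iter_derive s phi) x.

(* All Schwartz seminorms of order at most N are bounded by B. *)
Definition seminorm_le (N : nat) phi (B : R) :=
  forall (k : nat) (s : seq 'I_d) (x : 'rV[R]_d), (k <= N)%N -> (size s <= N)%N ->
    `|x| ^+ k * `|iter_derive s phi x| <= B.

Definition schwartz phi := smooth phi /\ forall N, exists B, seminorm_le N phi B.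

(* A distribution is encoded by its action on all functions; only its values
   on Schwartz functions are meaningful. *)
Definition tempered_distribution (T : ('rV[R]_d -> R) -> R) :=
  (forall (a : R) phi psi, schwartz phi -> schwartz psi ->
     T (fun x => a * phi x + psi x) = a * T phi + T psi) /\
  (exists (N : nat) (C : R), forall phi B,
     schwartz phi -> seminorm_le N phi B -> `|T phi| <= C * B).

Definition test_function Omega phi :=
  smooth phi /\
  exists K, [/\ compact K, K `<=` Omega & forall x, ~ K x -> phi x = 0].

End distributions.

(* Elements of H are functions on R^d up to equality almost everywhere;
   [ev] picks a representative. *)
Definition function_space (R : realType) (d : nat) (H : lmodType R)
    (ev : H -> 'rV[R]_d -> R) :=
  [/\ forall f, measurable_fun_Rd (ev f),
      forall (a : R) f g,
        ae_eq_Rd (ev (a *: f + g)) (fun x => a * ev f x + ev g x) &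
      forall f g, ae_eq_Rd (ev f) (ev g) -> f = g].

Definition hilbert_norm (R : realType) (H : normedModType R)
    (dot : {dot H for @idfun R}) :=
  forall x : H, `|x| ^+ 2 = dot x x.

(* L is only defined on the subspace D. *)
Definition linear_on (R : realType) (V W : lmodType R) (D : set V) (L : V -> W) :=
  D 0 /\ forall (a : R) u v, D u -> D v ->
    D (a *: u + v) /\ L (a *: u + v) = a *: L u + L v.

Definition adjoint (R : realType) (X Y : lmodType R)
    (dotX : {dot X for @idfun R}) (dotY : {dot Y for @idfun R})
    (S : X -> Y) (S' : Y -> X) :=
  forall f u, dotY (S f) u = dotX f (S' u).

Definition compact_operator (R : realType) (X Y : normedModType R) (T : X -> Y) :=
  forall A : set X, bounded_set A -> compact (closure (T @` A)).

Definition orthonormal_basis (R : realType) (H : normedModType R)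
    (dot : {dot H for @idfun R}) (e : nat -> H) :=
  (forall i j, dot (e i) (e j) = (i == j)%:R) /\
  closure [set \sum_(i < m) c i *: e i | m in [set: nat] & c in [set: nat -> R]]
    = [set: H].

Section green.
Context (R : realType) (d : nat) (X Y : lmodType R).
Variables (evX : X -> 'rV[R]_d -> R) (evY : Y -> 'rV[R]_d -> R).
Variable (Omega : set 'rV[R]_d).

(* psi is the formal transpose of L applied to phi, as seen from the domain D. *)
Definition formal_transpose (D : set Y) (L : Y -> X) (phi psi : 'rV[R]_d -> R) :=
  forall u, D u ->
    [/\ integrable_Rd Omega (fun x => evX (L u) x * phi x),
        integrable_Rd Omega (fun x => evY u x * psi x) &
        integral_Rd Omega (fun x => evX (L u) x * phi x) =
        integral_Rd Omega (fun x => evY u x * psi x)].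

(* T solves L T = delta_z in Omega, tested against functions supported in Omega. *)
Definition weak_delta_solution (D : set Y) (L : Y -> X) (z : 'rV[R]_d)
    (T : ('rV[R]_d -> R) -> R) :=
  forall phi psi, test_function Omega phi -> test_function Omega psi ->
    formal_transpose D L phi psi -> T psi = phi z.

Definition green_function (D : set Y) (L : Y -> X)
    (G : 'rV[R]_d -> ('rV[R]_d -> R) -> R) :=
  forall z, Omega z -> tempered_distribution (G z) /\ weak_delta_solution D L z (G z).

(* S f = \int_Omega G(.; z) f(z) dz, as distributions in Omega. *)
Definition green_representation (S : X -> Y)
    (G : 'rV[R]_d -> ('rV[R]_d -> R) -> R) :=
  forall f phi, test_function Omega phi ->
    [/\ integrable_Rd Omega (fun x => evY (S f) x * phi x),
        integrable_Rd Omega (fun z => G z phi * evX f z) &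
        integral_Rd Omega (fun x => evY (S f) x * phi x) =
        integral_Rd Omega (fun z => G z phi * evX f z)].

End green.

(* Infima and suprema are taken in \bar R, so that they always exist; that they
   are attained is asserted separately. *)
Section kolmogorov.
Context (R : realType) (X Y : normedModType R) (S : X -> Y) (n : nat).

Definition relative_error (v : 'I_n -> X) (f : X) (c : 'I_n -> R) : R :=
  `|S f - \sum_(i < n) c i *: S (v i)| / `|f|.

Definition best_error (v : 'I_n -> X) (f : X) : \bar R :=
  ereal_inf [set (relative_error v f c)%:E | c in [set: 'I_n -> R]].

Definition worst_error (v : 'I_n -> X) : \bar R :=
  ereal_sup [set best_error v f | f in [set f : X | f != 0]].

Definition kolmogorov_width : \bar R :=
  ereal_inf [set worst_error v | v in [set: 'I_n -> X]].

End kolmogorov.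

(* Main.v *)
Require Import Defs.
From HB Require Import structures.
From mathcomp Require Import all_boot all_order all_algebra sesquilinear.
From mathcomp Require Import all_classical all_reals all_analysis.
From mathcomp Require Import ring lra.

Set Implicit Arguments.
Unset Strict Implicit.
Unset Printing Implicit Defensive.

Import Order.TTheory GRing.Theory Num.Theory.
Import numFieldNormedType.Exports.

Local Open Scope classical_set_scope.
Local Open Scope ring_scope.

(** Write [T f] for the part of [S f] orthogonal to the span of
   [S (v 0), ..., S (v n.-1)]. Its norm is the best error at [f], and the
   orthogonal projection gives the optimal coefficients ([residual_orthogonal],
   [residual_le], [best_errorE]).

   Upper bound: for [v = vhat] the error at a finite combination of the [vhat i]
   is the norm of the terms of index at least [n] of its image, whose singular
   values are at most [lambda n]; density and continuity give the general case
   ([svd_tail_le]). This is also the last inequality of the theorem, as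
   [L (S f) = f].

   Lower bound: for any [v], the [n.+1] vectors [vhat 0, ..., vhat n] span a
   nonzero [f] with [S f] orthogonal to all the [S (v i)], since this is a system
   of [n] linear equations. No combination of the [S (v i)] improves on the zero
   one, and [|S f| >= lambda n * |f|] ([svd_lower_bound]).

   Attainment of the worst error: this is where compactness enters. The operator
   [A] defined by [<T f, T g> = <A f, g>] is [Sstar \o S] minus an operator of
   finite rank, hence compact, and the norm [M] of [T] is positive by the lower
   bound. A maximizing sequence [x] in the unit ball satisfies
   [A x - M^2 x --> 0]; along an ultrafilter [A x] converges, so [x] does too,
   and its limit is a maximizer ([norm_attained], [worst_error_attained]). *)

(** * Inner product spaces *)

Section inner_product.
Context (R : realType) (H : normedModType R) (dot : {dot H for @idfun R}).
Hypothesis dot_norm : hilbert_norm dot.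

Lemma dotC (x y : H) : dot x y = dot y x.
Proof. by rewrite hermC expr0 mul1r. Qed.

Lemma dotZl (a : R) (x y : H) : dot (a *: x) y = a * dot x y.
Proof. exact: linearZl_LR. Qed.

Lemma dotZr (a : R) (x y : H) : dot x (a *: y) = a * dot x y.
Proof. by rewrite dotC dotZl dotC. Qed.

Lemma norm_add_sqr (x y : H) :
  `|x + y| ^+ 2 = `|x| ^+ 2 + dot x y *+ 2 + `|y| ^+ 2.
Proof. by rewrite !dot_norm linearDl !linearDr /= (dotC y x); ring. Qed.

Lemma norm_sub_sqr (x y : H) :
  `|x - y| ^+ 2 = `|x| ^+ 2 - dot x y *+ 2 + `|y| ^+ 2.
Proof. by rewrite norm_add_sqr linearNr normrN mulNrn. Qed.

Lemma norm_le_of_sqr_le (V W : normedModType R) (x : V) (y : W) (a : R) :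
  0 <= a -> `|x| ^+ 2 <= a ^+ 2 * `|y| ^+ 2 -> `|x| <= a * `|y|.
Proof. by move=> a0; rewrite -exprMn ler_sqr ?nnegrE ?mulr_ge0. Qed.

Lemma cauchy_schwarz (x y : H) : `|dot x y| <= `|x| * `|y|.
Proof.
have [->|y0] := eqVneq y 0; first by rewrite linear0r normr0 mulr_ge0.
have yy : 0 < `|y| by rewrite normr_gt0.
rewrite -ler_sqr ?nnegrE ?mulr_ge0 // real_normK ?num_real //.
(* |y|^2 times |x|^2 |y|^2 - <x,y>^2 is the square of |y|^2 x - <x,y> y. *)
have := sqr_ge0 `|(`|y| ^+ 2) *: x - dot x y *: y|.
rewrite norm_sub_sqr !normrZ dotZl dotZr !exprMn.
rewrite (real_normK (num_real (dot x y))) normr_id => h.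
have {}h : 0 <= `|y| ^+ 2 * (`|x| ^+ 2 * `|y| ^+ 2 - dot x y ^+ 2).
  by apply: (le_trans h); rewrite le_eqVlt; apply/orP; left; apply/eqP; ring.
by rewrite -subr_ge0 -(pmulr_rge0 _ (exprn_gt0 2 yy)).
Qed.

Lemma norm_orthonormal_sum (e : nat -> H) (m : nat) (a : nat -> R) :
  (forall i j, dot (e i) (e j) = (i == j)%:R) ->
  `|\sum_(i < m) a i *: e i| ^+ 2 = \sum_(i < m) a i ^+ 2.
Proof.
move=> one; elim: m => [|m IH]; first by rewrite !big_ord0 normr0 expr0n.
rewrite !big_ord_recr /= norm_add_sqr IH normrZ dotZr linear_sumlz [X in _ * X]big1 => [|i _].
  by rewrite mulr0 mul0rn addr0 exprMn real_normK ?num_real // dot_norm one eqxx mulr1.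
by rewrite /= dotZl one ltn_eqF ?mulr0.
Qed.

(** The part of [y] left over after subtracting a combination of the [w i] whose
   coefficients are the scalar products of [y] with the [b i]. When it is
   orthogonal to all the [w i], this is the orthogonal projection of [y] onto the
   complement of their span; taking the [b i] as data makes it visibly linear. *)
Definition residual (n : nat) (w b : 'I_n -> H) (y : H) : H :=
  y - \sum_(i < n) dot y (b i) *: w i.

Lemma residual_is_linear n (w b : 'I_n -> H) : linear (residual w b).
Proof.
move=> a x y; rewrite /residual scalerBr scaler_sumr addrACA -opprD -big_split /=.
congr (_ - _); apply: eq_bigr => i _.
by rewrite linearPl /= scalerDl scalerA.
Qed.

HB.instance Definition _ n (w b : 'I_n -> H) :=
  GRing.isLinear.Build R H H _ (residual w b) (residual_is_linear w b).

(** Gram-Schmidt, one vector at a time: adding a vector [v] to the family adds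
   the rank-one projection onto its residual [r], and nothing if [r = 0]. The
   new dual vector is [r / |r|^2]; the other ones are corrected so that [v]
   itself is replaced by [r] in the combination. *)
Lemma residual_orthogonal n (w : 'I_n -> H) :
  exists b : 'I_n -> H, forall y i, dot (residual w b y) (w i) = 0.
Proof.
elim: n w => [|n IH] w; first by exists w => y [].
have [b bP] := IH (fun i => w (lift ord0 i)).
set res := residual _ b in bP.
set v := w ord0; set r := res v.
pose b0 := (`|r| ^- 2) *: r.
pose b' i := if unlift ord0 i is Some j then b j - dot v (b j) *: b0 else b0.
have resE y : residual w b' y = res y - dot y b0 *: r.
  rewrite /residual big_ord_recl /b' unlift_none -/v.
  under eq_bigr => j _ do
    rewrite liftK linearBr /= dotZr (mulrC (dot v _)) scalerBl -scalerA.
  rewrite sumrB -scaler_sumr /r /res /residual scalerBr !opprB opprD opprB -!addrA.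
  by congr (_ + _); rewrite addrC -addrA addrCA.
exists b' => y i; rewrite resE.
have [j ->|->] := unliftP ord0 i; first by rewrite linearBl /= dotZl !bP mulr0 subrr.
have resP z : res z = z - \sum_(j < n) dot z (b j) *: w (lift ord0 j) by [].
have rv z : dot (res z) v = dot (res z) r.
  rewrite /r (resP v) linearBr linear_sumr big1 ?subr0 // => j _.
  by rewrite /= dotZr bP mulr0.
have ry : dot y r = dot (res y) r.
  rewrite (resP y) linearBl linear_sumlz big1 ?subr0 // => j _.
  by rewrite /= dotZl (dotC (w _)) bP mulr0.
rewrite -/v linearBl /= dotZl rv rv /b0 dotZr ry -dot_norm.
have [r0|r0] := eqVneq r 0; first by rewrite r0 linear0r normr0 mulr0 mul0r subrr.
by rewrite mulrAC mulVf ?mul1r ?subrr // expf_neq0 // normr_eq0.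
Qed.

(** Pythagoras: replacing the dual coefficients by others moves the residual by
   an element of the span, which is orthogonal to it. *)
Lemma residual_le n (w b : 'I_n -> H) (y : H) (c : 'I_n -> R) :
  (forall y i, dot (residual w b y) (w i) = 0) ->
  `|residual w b y| <= `|y - \sum_(i < n) c i *: w i|.
Proof.
move=> bP; rewrite -ler_sqr ?nnegrE //.
set z := \sum_(i < n) (dot y (b i) - c i) *: w i.
have -> : y - \sum_(i < n) c i *: w i = residual w b y + z.
  rewrite /residual -addrA; congr (_ + _).
  by rewrite -!sumrN -big_split; apply: eq_bigr => i _ /=; rewrite scalerBl addKr.
rewrite (norm_add_sqr (residual w b y) z) linear_sumr big1 => [|i _].
  by rewrite mul0rn addr0 lerDl sqr_ge0.
by rewrite /= dotZr bP mulr0.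
Qed.

End inner_product.

(** * Compact operators and attained norms *)

Lemma ultra_fmap (I T : Type) (f : I -> T) (F : set_system I) :
  UltraFilter F -> UltraFilter (f @ F).
Proof.
move=> FU; split=> [|G GF FG]; first exact: fmap_proper_filter.
apply/seteqP; split=> [A GA|]; last exact: FG.
have [//|FnA] := in_ultra_setVsetC (f @^-1` A) FU.
have GnA : G (~` A) by apply: FG.
by have [? []] := filter_ex (filterI GA GnA).
Qed.

Lemma compact_ultra_cvg (I : Type) (T : ptopologicalType) (K : set T)
    (F : set_system I) (x : I -> T) :
  UltraFilter F -> compact K -> (forall i, K (x i)) -> cvg (x i @[i --> F]).
Proof.
move=> FU; rewrite compact_ultra => /(_ _ (ultra_fmap x FU)) + Kx.
by case=> [|l [_ xl]]; [exact: (@filterE _ F _ (x @^-1` K))|apply/cvg_ex; exists l].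
Qed.

Lemma linear_continuous_of_bound (R : realType) (V W : normedModType R)
    (T : {linear V -> W}) (K : R) :
  0 <= K -> (forall f, `|T f| <= K * `|f|) -> continuous T.
Proof.
move=> K0 TK; apply/linear_bounded_continuous/bounded_funP => r; exists (K * r).
by move=> f fr; apply: (le_trans (TK f)); rewrite ler_wpM2l.
Qed.

Section attained.
Context (R : realType) (X Y : normedModType R).
Context (dotX : {dot X for @idfun R}) (dotY : {dot Y for @idfun R}).
Hypotheses (hX : hilbert_norm dotX) (hY : hilbert_norm dotY).

(** Compactness in the form used to pass to the limit: convergence along an
   ultrafilter replaces the extraction of subsequences, and is stable under sums
   without any further extraction. *)
Definition ultra_compact (A : X -> X) :=
  forall (F : set_system nat) (x : nat -> X), UltraFilter F ->
    (forall k, `|x k| <= 1) -> cvg (A (x k) @[k --> F]).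

Lemma ultra_compact_of_compact (A : X -> X) :
  compact_operator A -> ultra_compact A.
Proof.
move=> cA F x FU x1.
have cB : compact (closure (A @` [set y | `|y| <= 1])).
  by apply: cA; exists 1; split=> // M /ltW M1 y /= y1; exact: le_trans M1.
apply: compact_ultra_cvg cB _ => k; apply: subset_closure.
by exists (x k) => //=.
Qed.

Lemma ultra_compact_sub (A B : X -> X) :
  ultra_compact A -> ultra_compact B -> ultra_compact (fun f => A f - B f).
Proof. by move=> cA cB F x FU x1; apply: is_cvgB; [exact: cA|exact: cB]. Qed.

(** The coefficients stay in segments of the real line, which are compact. *)
Lemma ultra_compact_finite_rank n (g w : 'I_n -> X) :
  ultra_compact (fun f => \sum_(i < n) dotX f (g i) *: w i).
Proof.
move=> F x FU x1; apply/cvg_ex.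
pose l i := lim ((dotX (x k) (g i) *: w i) @[k --> F]).
exists (\sum_(i < n) l i); apply: cvg_big => [|i _]; first exact: add_continuous.
apply: is_cvgZr_tmp.
apply: (compact_ultra_cvg FU (@segment_compact _ (- `|g i|) `|g i|)) => k.
rewrite /= in_itv /= -ler_norml (le_trans (cauchy_schwarz hX _ _)) //.
by rewrite ler_piMl.
Qed.

(** A maximizing sequence [x k] in the unit ball satisfies [A x - M^2 x --> 0]
   for [A = T^* T] and [M] the norm of [T], because
   [|A x - M^2 x|^2 <= 2 M^2 (M^2 - |T x|^2)]. Since [A x k] converges along
   an ultrafilter, so does [x k], and its limit is a maximizer. *)
Lemma norm_attained (T : {linear X -> Y}) (A : X -> X) (K : R) (f0 : X) :
    (forall f g, dotY (T f) (T g) = dotX (A f) g) -> ultra_compact A ->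
    (forall f, `|T f| <= K * `|f|) -> T f0 != 0 ->
  exists2 f, f != 0 & forall g, `|T g| / `|g| <= `|T f| / `|f|.
Proof.
move=> adj cA TK Tf0.
have f0_neq0 : f0 != 0 by apply: contraNneq Tf0 => ->; rewrite linear0.
have K0 : 0 <= K.
  have := le_trans (normr_ge0 _) (TK f0).
  by rewrite pmulr_lge0 // normr_gt0.
pose E := [set `|T f| | f in [set f : X | `|f| <= 1]].
have E_ub : has_ubound E.
  exists K => _ [f /= f1 <-]; apply: (le_trans (TK f)).
  by rewrite ler_piMr.
have E_sup : has_sup E by split=> //; exists `|T 0|, 0 => //=; rewrite normr0.
set M := sup E.
have TM1 f : `|f| <= 1 -> `|T f| <= M.
  by move=> f1; apply: sup_upper_bound => //; exists f.
have TM f : `|T f| <= M * `|f|.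
  have [->|f_neq0] := eqVneq f 0; first by rewrite linear0 !normr0 mulr0.
  have nf : 0 < `|f| by rewrite normr_gt0.
  rewrite -ler_pdivrMr //; have := TM1 (`|f|^-1 *: f).
  rewrite linearZ /= !normrZ normfV normr_id mulVf ?gt_eqF // => /(_ (lexx _)).
  by rewrite mulrC.
have M0 : 0 < M.
  have : 0 < M * `|f0| by apply: lt_le_trans (TM f0); rewrite normr_gt0.
  by rewrite pmulr_lgt0 // normr_gt0.
(* |A f|^2 = <T f, T (A f)> <= M |f| M |A f| *)
have AM f : `|A f| <= M ^+ 2 * `|f|.
  have [->|Af0] := eqVneq (A f) 0; first by rewrite normr0 mulr_ge0 ?sqr_ge0.
  have nAf : 0 < `|A f| by rewrite normr_gt0.
  rewrite -(ler_pM2r nAf) -expr2 hX -adj.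
  apply: (le_trans (ler_norm _)); apply: (le_trans (cauchy_schwarz hY _ _)).
  rewrite (_ : _ * _ * `|A f| = (M * `|f|) * (M * `|A f|)); last by ring.
  exact: ler_pM.
have /choice[x xP] k : exists f, `|f| <= 1 /\ M - k.+1%:R^-1 < `|T f|.
  have k0 : (0 : R) < k.+1%:R^-1 by rewrite invr_gt0.
  by have [_ [f f1 <-] Mf] := sup_adherent k0 E_sup; exists f.
have [F [FU /(_ _ _) ooF]] := ultraFilterLemma (F := \oo) _.
have Tx : `|T (x k)| @[k --> F] --> M.
  apply: (cvg_trans (G := `|T (x k)| @[k --> \oo])) => [B /= ?|]; first exact: ooF.
  apply: (squeeze_cvgr (f := fun k => M - k.+1%:R^-1) (h := fun=> M)).
  - by apply: nearW => k; have [xk1 /ltW ->] := xP k; rewrite TM1.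
  - by rewrite -[X in _ --> X]subr0; apply: cvgB; [exact: cvg_cst|exact: cvg_harmonic].
  - exact: cvg_cst.
have /cvg_ex[g Ag] : cvg (A (x k) @[k --> F]) by apply: cA => // k; have [] := xP k.
have err : (A (x k) - (M ^+ 2) *: x k) @[k --> F] --> (0 : X).
  apply/norm_cvg0P.
  have sq0 : `|A (x k) - M ^+ 2 *: x k| ^+ 2 @[k --> F] --> (0 : R).
    apply: (squeeze_cvgr (f := fun=> 0)
      (h := fun k => (M ^+ 2 * (M ^+ 2 - `|T (x k)| ^+ 2)) *+ 2)).
    + apply: nearW => k; rewrite sqr_ge0 /=.
      have [xk1 _] := xP k.
      rewrite (norm_sub_sqr hX) dotZr -adj -hY normrZ.
      have a1 : `|A (x k)| ^+ 2 <= (M ^+ 2) ^+ 2.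
        rewrite ler_sqr ?nnegrE ?sqr_ge0 //; apply: (le_trans (AM _)).
        by rewrite ler_piMr ?sqr_ge0.
      have a2 : (`|M ^+ 2| * `|x k|) ^+ 2 <= (M ^+ 2) ^+ 2.
        rewrite (ger0_norm (sqr_ge0 M)) ler_sqr ?nnegrE ?mulr_ge0 ?(ltW M0) ?sqr_ge0 //.
        by rewrite ler_piMr ?sqr_ge0.
      by nra.
    + exact: cvg_cst.
    + rewrite [X in _ --> X](_ : 0 = (M ^+ 2 * (M ^+ 2 - M ^+ 2)) *+ 2).
        apply: cvgMn; apply: cvgM; first exact: cvg_cst.
        apply: cvgB; first exact: cvg_cst.
        exact: (cvgM Tx Tx).
      by rewrite subrr mulr0 mul0rn.
  have := cvg_comp _ _ sq0 (@sqrt_continuous R 0); rewrite sqrtr0.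
  apply: cvg_trans; apply: near_eq_cvg; apply: nearW => k /=.
  by rewrite sqrtr_sqr normr_id.
have M2 : M ^+ 2 != 0 by rewrite sqrf_eq0 gt_eqF.
have xf : x k @[k --> F] --> M ^- 2 *: g.
  have -> : x = M ^- 2 *: ((A \o x) - (fun k => A (x k) - M ^+ 2 *: x k)).
    by apply/funext => k /=; rewrite subKr scalerA mulVf // scale1r.
  by rewrite -[X in _ --> _ *: X]subr0; apply: cvgZl_tmp; apply: cvgB.
set f := M ^- 2 *: g in xf.
have T_cont : continuous T := linear_continuous_of_bound K0 TK.
have Tf : `|T f| = M.
  have h : `|T (x k)| @[k --> F] --> `|T f|.
    by apply: cvg_norm; apply: (cvg_comp _ _ xf); exact: T_cont.
  exact: (cvg_unique _ h Tx).
have f1 : `|f| <= 1.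
  by apply: (cvgr_to_le (cvg_norm xf)); apply: nearW => k; have [] := xP k.
have nf : 0 < `|f|.
  rewrite normr_gt0; apply: contraTneq M0 => f_eq0.
  by rewrite -Tf f_eq0 linear0 normr0 ltxx.
exists f => [|h]; first by rewrite -normr_gt0.
have [->|h0] := eqVneq h 0.
  by rewrite linear0 normr0 mul0r divr_ge0.
rewrite Tf ler_pdivrMr ?normr_gt0 //; apply: (le_trans (TM h)).
by rewrite ler_wpM2r // ler_pdivlMr // ler_piMr // ltW.
Qed.

End attained.

(** * Singular value expansions *)

Section singular_values.
Context (R : realType) (X Y : normedModType R).
Context (dotX : {dot X for @idfun R}) (dotY : {dot Y for @idfun R}).
Hypotheses (hX : hilbert_norm dotX) (hY : hilbert_norm dotY).
Context (S : {linear X -> Y}) (Sstar : {linear Y -> X}).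
Hypotheses (S_bounded : bounded_near S (nbhs 0))
  (S_adjoint : adjoint dotX dotY S Sstar).
Context (lambda : nat -> R) (uhat : nat -> Y) (vhat : nat -> X).
Hypotheses (S_vhat : forall i, S (vhat i) = lambda i *: uhat i)
  (Sstar_uhat : forall i, Sstar (uhat i) = lambda i *: vhat i)
  (basis_uhat : orthonormal_basis dotY uhat)
  (basis_vhat : orthonormal_basis dotX vhat)
  (lambda_gt0 : forall i, 0 < lambda i)
  (lambda_decr : forall i, lambda i.+1 < lambda i).

Lemma lambda_anti i j : (i <= j)%N -> lambda j <= lambda i.
Proof. by move: i j; apply/nonincreasing_seqP => k; exact: ltW. Qed.

(** The truncation error is [S] followed by the residual of the orthonormal
   family [uhat], which is its own dual; in this form its linearity and its
   continuity are inherited from those of the two factors. *)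
Definition svd_tail (n : nat) : {linear X -> Y} :=
  @residual R Y dotY n (fun i => uhat i) (fun i => uhat i) \o S.

Lemma svd_tailE n f :
  svd_tail n f = S f - \sum_(i < n) (lambda i * dotX f (vhat i)) *: uhat i.
Proof.
rewrite /svd_tail /= /residual; congr (_ - _); apply: eq_bigr => i _.
by rewrite S_adjoint Sstar_uhat dotZr.
Qed.

Lemma svd_tail_vhat n i :
  svd_tail n (vhat i) = (if (i < n)%N then 0 else lambda i) *: uhat i.
Proof.
rewrite svd_tailE S_vhat.
under eq_bigr => j _ do rewrite basis_vhat.1.
case: ltnP => [lt_in|le_ni].
  rewrite (bigD1 (Ordinal lt_in)) //= eqxx mulr1 big1 ?addr0 ?subrr ?scale0r //.
  move=> j ji; rewrite (_ : (i == j) = false) ?mulr0 ?scale0r //.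
  by apply: contraNF ji => /eqP ij; apply/eqP/val_inj.
rewrite big1 ?subr0 // => j _.
by rewrite gtn_eqF ?mulr0 ?scale0r // (leq_trans _ le_ni).
Qed.

Lemma svd_tail_continuous n : continuous (svd_tail n).
Proof.
have /linear_bounded_continuous S_cont := S_bounded.
move=> f; apply: continuous_comp; first exact: S_cont.
apply: (@linear_continuous_of_bound _ _ _ _ 1) => // y.
rewrite mul1r; apply: le_trans (residual_le hY y (fun=> 0) _) _.
  move=> {}y i; rewrite /residual linearBl linear_sumlz (bigD1 i) //=.
  rewrite dotZl basis_uhat.1 eqxx mulr1 big1 ?addr0 ?subrr // => j ji.
  by rewrite dotZl basis_uhat.1 (negbTE (_ : (j : nat) != i)) ?mulr0.
by rewrite big1 ?subr0 // => i _; rewrite scale0r.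
Qed.

(** On a finite combination of the [vhat i] the bound is an inequality between
   the squares of the coefficients; both sides are continuous and such
   combinations are dense. *)
Lemma svd_tail_le n f : `|svd_tail n f| <= lambda n * `|f|.
Proof.
rewrite -subr_le0.
have : closure ((fun f => `|svd_tail n f| - lambda n * `|f|) @^-1` [set x | x <= 0]) f.
  have : [set: X] f by [].
  rewrite -basis_vhat.2; apply: closureS => _ [m _ [a _ <-]].
  have tailE : svd_tail n (\sum_(i < m) a i *: vhat i) =
      \sum_(i < m) (a i * (if (i < n)%N then 0 else lambda i)) *: uhat i.
    rewrite linear_sum; apply: eq_bigr => i _.
    by rewrite linearZ_LR svd_tail_vhat scalerA.
  rewrite /preimage /mkset tailE subr_le0.
  apply: norm_le_of_sqr_le; first exact: ltW.
  rewrite (norm_orthonormal_sum hX m a basis_vhat.1).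
  rewrite (norm_orthonormal_sum hY m
    (fun i => a i * (if (i < n)%N then 0 else lambda i)) basis_uhat.1).
  rewrite mulr_sumr ler_sum // => i _; rewrite exprMn mulrC ler_wpM2r ?sqr_ge0 //.
  case: ltnP => [_|ni]; first by rewrite expr0n sqr_ge0.
  by rewrite ler_sqr ?nnegrE ?(ltW (lambda_gt0 _)) // lambda_anti.
apply: preimage_closed; last exact: closed_le.
move=> g _; apply: cvgB.
  by apply: cvg_norm; exact: svd_tail_continuous.
by apply: cvgM; [exact: cvg_cst|exact: norm_continuous].
Qed.

Lemma S_le f : `|S f| <= lambda 0 * `|f|.
Proof. by have := svd_tail_le 0 f; rewrite svd_tailE big_ord0 subr0. Qed.

(** Dimension count: among the [n+1]-dimensional span of [vhat 0, ..., vhat n]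
   some nonzero [f] satisfies the [n] linear equations that make [S f]
   orthogonal to every [S (v i)]. *)
Lemma svd_lower_bound n (v : 'I_n -> X) :
  exists2 f : X, f != 0 & forall c : 'I_n -> R,
    lambda n * `|f| <= `|S f - \sum_(i < n) c i *: S (v i)|.
Proof.
pose M : 'M[R]_(n.+1, n) := \matrix_(k, i) dotY (S (vhat k)) (S (v i)).
have kerM : kermx M != 0.
  by rewrite kermx_eq0 /row_free neq_ltn ltnS rank_leq_col.
pose r := nz_row (kermx M).
have r0 : r != 0 by rewrite nz_row_eq0.
have rM : r *m M = 0 by apply/sub_kermxP; exact: nz_row_sub.
pose a k := r 0 (inord k).
have aE (k : 'I_n.+1) : a k = r 0 k by rewrite /a inord_val.
pose f := \sum_(k < n.+1) a k *: vhat k.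
have Sf : S f = \sum_(k < n.+1) (a k * lambda k) *: uhat k.
  by rewrite linear_sum; apply: eq_bigr => k _; rewrite linearZ /= S_vhat scalerA.
have orth i : dotY (S f) (S (v i)) = 0.
  have /matrixP/(_ 0 i) := rM; rewrite !mxE => <-.
  rewrite linear_sum linear_sumlz; apply: eq_bigr => k _.
  by rewrite linearZ /= dotZl mxE aE.
have nf : `|f| ^+ 2 = \sum_(k < n.+1) a k ^+ 2.
  exact: (norm_orthonormal_sum hX n.+1 a basis_vhat.1).
exists f => [|c].
  apply: contraNneq r0 => f0; apply/eqP/rowP => k; rewrite mxE -aE.
  move/eqP: nf; rewrite f0 normr0 expr0n eq_sym psumr_eq0 => [/allP/(_ k)|j _].
    by rewrite mem_index_enum sqrf_eq0 => /(_ isT)/eqP.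
  exact: sqr_ge0.
apply: le_trans (_ : `|S f| <= _).
  rewrite -ler_sqr ?nnegrE ?mulr_ge0 ?(ltW (lambda_gt0 _)) // exprMn nf Sf.
  rewrite (norm_orthonormal_sum hY n.+1 (fun k => a k * lambda k) basis_uhat.1).
  rewrite mulr_sumr ler_sum // => k _; rewrite exprMn mulrC ler_wpM2l ?sqr_ge0 //.
  by rewrite ler_sqr ?nnegrE ?(ltW (lambda_gt0 _)) // lambda_anti // -ltnS.
rewrite -ler_sqr ?nnegrE // (norm_sub_sqr hY (S f)) linear_sumr big1 => [|i _].
  by rewrite mul0rn subr0 lerDl sqr_ge0.
by rewrite /= dotZr orth mulr0.
Qed.

Lemma best_errorE n (v : 'I_n -> X) (b : 'I_n -> Y) f :
  (forall y i, dotY (residual dotY (S \o v) b y) (S (v i)) = 0) ->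
  best_error S v f =
    (relative_error S v f (fun i => dotY (S f) (b i)))%:E.
Proof.
move=> bP; apply/eqP; rewrite eq_le; apply/andP; split.
  by apply: ereal_inf_lbound; eexists.
apply: le_ereal_inf_tmp => _ [c _ <-]; rewrite lee_fin.
by rewrite ler_wpM2r ?invr_ge0 //; exact: (residual_le hY (S f) c bP).
Qed.

(** The optimal error of [v] at [f] is the norm of [T f], where [T] is [S]
   followed by a projection of finite corank, so that [T^* T] differs from
   [S^* S] by an operator of finite rank. *)
Lemma worst_error_attained n (v : 'I_n -> X) :
    compact_operator (Sstar \o S) ->
  exists2 f : X, f != 0 & worst_error S v = best_error S v f.
Proof.
move=> cSS; have [b bP] := residual_orthogonal hY (S \o v).
pose T : {linear X -> Y} := residual dotY (S \o v) b \o S.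
pose A f := Sstar (S f) -
  \sum_(i < n) dotX f (Sstar (b i)) *: Sstar (S (v i)).
have adj f g : dotY (T f) (T g) = dotX (A f) g.
  have -> : dotY (T f) (T g) = dotY (S g) (T f).
    rewrite /T /= {2}/residual linearBr linear_sumr big1 ?subr0 1?dotC // => i _.
    by rewrite /= dotZr bP mulr0.
  rewrite S_adjoint dotC; congr (dotX _ g).
  rewrite /T /= /residual linearB linear_sum; congr (_ - _).
  by apply: eq_bigr => i _; rewrite linearZ /= S_adjoint.
have cA : ultra_compact A.
  apply: ultra_compact_sub; first exact: (ultra_compact_of_compact cSS).
  exact: ultra_compact_finite_rank.
have Tle f : `|T f| <= lambda 0 * `|f|.
  apply: le_trans (S_le f).
  apply: (le_trans (residual_le hY (S f) (fun=> 0) bP)).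
  by rewrite big1 ?subr0 // => i _; rewrite scale0r.
have [f0 f0_neq0 /(_ (fun i => dotY (S f0) (b i)))] := svd_lower_bound v.
move=> /(lt_le_trans (mulr_gt0 (lambda_gt0 n) _)).
rewrite !normr_gt0 => /(_ f0_neq0) Tf0.
have [f f_neq0 fP] := norm_attained hX hY adj cA Tle Tf0.
exists f => //; apply/eqP; rewrite eq_le; apply/andP; split; last first.
  by apply: ereal_sup_ubound; exists f.
apply: ge_ereal_sup => _ [g _ <-].
by rewrite !(best_errorE _ bP) lee_fin; exact: fP.
Qed.

Lemma worst_error_ge n (v : 'I_n -> X) : ((lambda n)%:E <= worst_error S v)%E.
Proof.
have [f f0 fP] := svd_lower_bound v.
apply: (@le_trans _ _ (best_error S v f)); last first.
  by apply: ereal_sup_ubound; exists f.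
apply: le_ereal_inf_tmp => _ [c _ <-]; rewrite lee_fin.
by rewrite ler_pdivlMr ?normr_gt0.
Qed.

Lemma worst_error_vhat_le n :
  (worst_error S (fun i : 'I_n => vhat i) <= (lambda n)%:E)%E.
Proof.
apply: ge_ereal_sup => _ [f /= f0 <-].
apply: (@le_trans _ _
  (relative_error S (fun i : 'I_n => vhat i) f (fun i => dotX f (vhat i)))%:E).
  by apply: ereal_inf_lbound; eexists.
rewrite lee_fin ler_pdivrMr ?normr_gt0 //; apply: le_trans (svd_tail_le n f).
rewrite svd_tailE le_eqVlt; apply/orP; left; apply/eqP; congr `|_ - _|.
by apply: eq_bigr => i _; rewrite S_vhat scalerA mulrC.
Qed.

Lemma kolmogorov_widthE n : kolmogorov_width S n = (lambda n)%:E.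
Proof.
apply/eqP; rewrite eq_le; apply/andP; split.
  apply: le_trans (worst_error_vhat_le n).
  by apply: ereal_inf_lbound; eexists.
by apply: le_ereal_inf_tmp => _ [v _ <-]; exact: worst_error_ge.
Qed.

End singular_values.

(* Sequences are indexed from 0: lambda i, uhat i, vhat i are the (i+1)-th
   singular value and functions, so lambda n is the (n+1)-th singular value. *)
Theorem theorem2p1 (R : realType) (d : nat)
  (X Y : completeNormedModType R)
  (dotX : {dot X for @idfun R}) (dotY : {dot Y for @idfun R})
  (hilbertX : hilbert_norm dotX) (hilbertY : hilbert_norm dotY)
  (evX : X -> 'rV[R]_d -> R) (evY : Y -> 'rV[R]_d -> R)
  (funX : function_space evX) (funY : function_space evY)
  (Omega : set 'rV[R]_d) (measurable_Omega : measurable_set_Rd Omega)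
  (D : set Y) (L : Y -> X) (linear_L : linear_on D L)
  (G : 'rV[R]_d -> ('rV[R]_d -> R) -> R)
  (green_G : green_function evX evY Omega D L G)
  (S : {linear X -> Y})
  (S_green : green_representation evX evY Omega S G)
  (S_bounded : bounded_near S (nbhs 0)) (S_injective : injective S)
  (S_solution : forall (f : X) (u : Y), (D u /\ L u = f) <-> u = S f)
  (Sstar : {linear Y -> X}) (S_adjoint : adjoint dotX dotY S Sstar)
  (SstarS_compact : compact_operator (Sstar \o S))
  (lambda : nat -> R) (uhat : nat -> Y) (vhat : nat -> X)
  (S_vhat : forall i, S (vhat i) = lambda i *: uhat i)
  (Sstar_uhat : forall i, Sstar (uhat i) = lambda i *: vhat i)
  (basis_uhat : orthonormal_basis dotY uhat)
  (basis_vhat : orthonormal_basis dotX vhat)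
  (lambda_gt0 : forall i, 0 < lambda i)
  (lambda_decr : forall i, lambda i.+1 < lambda i)
  (n : nat) (n_gt0 : (0 < n)%N) :
  [/\ (* the minima over c and the maxima over f in the n-width are attained *)
      forall (v : 'I_n -> X) (f : X), f != 0 ->
        exists c : 'I_n -> R, best_error S v f = (relative_error S v f c)%:E,
      forall v : 'I_n -> X,
        exists2 f : X, f != 0 & worst_error S v = best_error S v f,
      kolmogorov_width S n = (lambda n)%:E,
      (* the outer minimum is attained at the first n right singular functions *)
      worst_error S (fun i : 'I_n => vhat i) = kolmogorov_width S n &
      forall u : Y, range S u ->
        `|u - \sum_(i < n) (lambda i * dotX (L u) (vhat i)) *: uhat i|
        <= lambda n * `|L u|].
Proof.
split.
- move=> v f _; have [b bP] := residual_orthogonal hilbertY (S \o v).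
  by exists (fun i => dotY (S f) (b i)); exact: best_errorE.
- by move=> v; apply: (worst_error_attained hilbertX hilbertY S_bounded
    S_adjoint S_vhat Sstar_uhat basis_uhat basis_vhat).
- exact: (kolmogorov_widthE hilbertX hilbertY S_bounded S_adjoint S_vhat
    Sstar_uhat basis_uhat basis_vhat).
- rewrite (kolmogorov_widthE hilbertX hilbertY S_bounded S_adjoint S_vhat
    Sstar_uhat basis_uhat basis_vhat) //.
  apply/eqP; rewrite eq_le; apply/andP; split.
    exact: (worst_error_vhat_le hilbertX hilbertY S_bounded S_adjoint S_vhat
      Sstar_uhat basis_uhat basis_vhat).
  exact: (worst_error_ge hilbertX hilbertY S_vhat basis_uhat basis_vhat).
move=> _ [f _ <-].
have [_ ->] : D (S f) /\ L (S f) = f by apply/S_solution.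
rewrite -(svd_tailE S_adjoint Sstar_uhat).
exact: (svd_tail_le hilbertX hilbertY S_bounded S_adjoint S_vhat
  Sstar_uhat basis_uhat basis_vhat).
Qed.
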